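(* Let $S$ be a positive semiring. Then the following statements hold: (1) If $0 \in \operatorname{pcomp}(S)$, then $0\leq s \leq 0^*$ for any $s\in S$. (2) If $s \in \operatorname{pcomp}(S)$, then $ss^* = 0$. In addition, if $s^* \in \operatorname{pcomp}(S)$, then $s^* s^{**} = 0$. (3) If $t\in \operatorname{pcomp}(S)$, then (for $s \in S$) $st = 0$ if and only if $s \leq t^*$. (4) If $s,s^* \in \operatorname{pcomp}(S)$, then $s \leq s^{**}$. (5) If $s,s^*, s^{**} \in \operatorname{pcomp}(S)$, then $s^{***} = s^*$. (6) If $s, s^* \in \operatorname{pcomp}(S)$, then (for $t \in S$) $st = 0$ if and only if $s^{**} t= 0$. (7) If $s,t \in \operatorname{pcomp}(S)$, then $s\leq t$ implies that $t^* \leq s^*$. (8) If $s,s^* \in \operatorname{pcomp}(S)$, then $s\in \operatorname{Skel}(S)$ if and only if $s^{**} = s$.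
   Context: A semiring is a set $S$ with operations $+,\cdot$ such that $(S,+)$ is a commutative monoid with identity $0$, $(S,\cdot)$ is a commutative monoid with identity $1\neq 0$, multiplication distributes over addition, and $s\cdot 0=0$ for all $s\in S$. An ordered semiring is a semiring with a partial order $\leq$ such that $s\leq t$ implies $s+u\leq t+u$ for all $u$, and $s\leq t$, $0\leq u$ imply $su\leq tu$. It is positive if $0\leq s$ for all $s\in S$. In an ordered semiring $S$, an element $s$ is pseudocomplemented if there is an element $s^*\in S$ (necessarily unique, called the pseudocomplement of $s$) such that $ss^*=0$ and, for each $x\in S$, $sx=0$ implies $x\leq s^*$. $\operatorname{pcomp}(S)$ is the set of pseudocomplemented elements of $S$, and $\operatorname{Skel}(S)=\{s^*: s\in \operatorname{pcomp}(S)\}$. Write $s^{**}=(s^* )^*$ and $s^{***}=(s^{**})^*$ when these exist. *)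

(* Defs.v *)
From mathcomp Require Import all_boot all_algebra.
From mathcomp Require Import boolp classical_sets.

Set Implicit Arguments.
Unset Strict Implicit.
Unset Printing Implicit Defensive.

Import GRing.Theory.

Local Open Scope classical_set_scope.
Local Open Scope ring_scope.

(* MathComp's [porderType] cannot be joined with semirings: its hierarchy
   already joins addition and order at [porderZmodType], which has additive
   inverses.  Hence a separate, Prop-valued order field. *)
Record orderedSemiRing := OrderedSemiRing {
  osr_car :> comNzSemiRingType;
  osr_le : osr_car -> osr_car -> Prop;
  osr_le_refl : forall s, osr_le s s;
  osr_le_anti : forall s t, osr_le s t -> osr_le t s -> s = t;
  osr_le_trans : forall t s u, osr_le s t -> osr_le t u -> osr_le s u;
  osr_leD2r : forall u s t, osr_le s t -> osr_le (s + u) (t + u);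
  osr_leM2r : forall u s t, osr_le s t -> osr_le 0 u ->
    osr_le (s * u) (t * u)
}.

Notation "s ⊑ t" := (osr_le s t) (at level 70, no associativity) : ring_scope.

Definition positive_semiring (S : orderedSemiRing) : Prop :=
  forall s : S, 0 ⊑ s.

Definition is_pseudocomplement (S : orderedSemiRing) (s p : S) : Prop :=
  s * p = 0 /\ forall x : S, s * x = 0 -> x ⊑ p.

Lemma is_pseudocomplement_unique (S : orderedSemiRing) (s p q : S) :
  is_pseudocomplement s p -> is_pseudocomplement s q -> p = q.
Proof.
by move=> [sp pmax] [sq qmax]; apply: osr_le_anti; [apply: qmax | apply: pmax].
Qed.

Definition Pcomp (S : orderedSemiRing) : set S :=
  [set s | exists p : S, is_pseudocomplement s p].
Arguments Pcomp S : clear implicits.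

(* [pstar s] is s^* when s is in [Pcomp S], and the junk value 0 otherwise. *)
Definition pstar (S : orderedSemiRing) (s : S) : S :=
  xget 0 [set p | is_pseudocomplement s p].

Lemma pstarP (S : orderedSemiRing) (s : S) :
  s \in Pcomp S -> is_pseudocomplement s (pstar s).
Proof. by rewrite inE => -[p sp]; apply: (xgetPex 0); exists p. Qed.

Definition Skel (S : orderedSemiRing) : set S :=
  [set pstar s | s in Pcomp S].
Arguments Skel S : clear implicits.

(* Main.v *)
Require Import Defs.
From mathcomp Require Import all_boot all_algebra.
From mathcomp Require Import boolp classical_sets.

Set Implicit Arguments.
Unset Strict Implicit.
Unset Printing Implicit Defensive.

Import GRing.Theory.

Local Open Scope classical_set_scope.
Local Open Scope ring_scope.

(** Positivity makes annihilation pass to smaller elements ([osr_mul_eq0]), so the annihilator of a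
    pseudocomplemented $t$ is exactly the down-set of $t^*$ ([mul_eq0_le_pstar]). As multiplication
    commutes, $s \leq t^*$ iff $t \leq s^*$: where defined, the star is an antitone Galois
    connection with itself. The other claims are the usual consequences, with [Skel S] as the closed
    elements. *)

Section Pseudocomplement.
Variables (S : orderedSemiRing) (posS : positive_semiring S).
Implicit Types s t u : S.

(** Squeeze: $0 \leq su \leq tu = 0$. *)
Lemma osr_mul_eq0 u s t : s ⊑ t -> t * u = 0 -> s * u = 0.
Proof.
move=> st tu; apply: osr_le_anti (posS _).
by rewrite -tu; apply: osr_leM2r (posS u).
Qed.

Lemma mul_pstar s : s \in Pcomp S -> s * pstar s = 0.
Proof. by case/pstarP. Qed.

Lemma mul_eq0_le_pstar s t : t \in Pcomp S -> s * t = 0 <-> s ⊑ pstar t.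
Proof.
move=> /pstarP[tt' tmax]; split=> [st|st].
  by apply: tmax; rewrite mulrC.
by apply: osr_mul_eq0 st _; rewrite mulrC.
Qed.

Lemma le_pstar2 s : s \in Pcomp S -> pstar s \in Pcomp S ->
  s ⊑ pstar (pstar s).
Proof. by move=> sP s'P; apply/mul_eq0_le_pstar => //; apply: mul_pstar. Qed.

Lemma pstar_anti s t : s \in Pcomp S -> t \in Pcomp S ->
  s ⊑ t -> pstar t ⊑ pstar s.
Proof.
move=> sP tP st; apply/mul_eq0_le_pstar => //.
by rewrite mulrC; apply: osr_mul_eq0 st (mul_pstar tP).
Qed.

(** One inequality is [le_pstar2] at $s^*$; the other is [le_pstar2] at $s$, reversed by
    [pstar_anti]. *)
Lemma pstar3 s : s \in Pcomp S -> pstar s \in Pcomp S ->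
  pstar (pstar s) \in Pcomp S -> pstar (pstar (pstar s)) = pstar s.
Proof.
move=> sP s1P s2P; apply: osr_le_anti; last exact: le_pstar2.
by apply: pstar_anti => //; apply: le_pstar2.
Qed.

Lemma pstar2_mul_eq0 s t : s \in Pcomp S -> pstar s \in Pcomp S ->
  s * t = 0 <-> pstar (pstar s) * t = 0.
Proof.
move=> sP s1P; split; last exact/osr_mul_eq0/le_pstar2.
(* From $st = 0$ one gets $t \leq s^*$, and $s^{**}$ annihilates $s^*$, hence also $t$. *)
rewrite mulrC [_ * t]mulrC => /(mul_eq0_le_pstar _ sP) ts.
exact: osr_mul_eq0 ts (mul_pstar s1P).
Qed.

Lemma Skel_pstar2 s : s \in Pcomp S -> pstar s \in Pcomp S ->
  s \in Skel S <-> pstar (pstar s) = s.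
Proof.
move=> sP s1P; split.
  (* With $s = u^*$, the hypotheses on $s$ and $s^*$ become those that [pstar3] asks of $u^*$ and
     $u^{**}$. *)
  rewrite inE => -[u /mem_set uP us]; rewrite -us in sP s1P *.
  exact: pstar3.
by move=> ss; rewrite inE; exists (pstar s) => //; apply: set_mem.
Qed.

End Pseudocomplement.

Theorem proposition2p5 (S : orderedSemiRing) (posS : positive_semiring S) :
  (* (1) *)
  (0 \in Pcomp S -> forall s : S, 0 ⊑ s /\ s ⊑ pstar 0) /\
  (* (2) *)
  (forall s : S, s \in Pcomp S ->
     s * pstar s = 0 /\
     (pstar s \in Pcomp S -> pstar s * pstar (pstar s) = 0)) /\
  (* (3) *)
  (forall t : S, t \in Pcomp S -> forall s : S, s * t = 0 <-> s ⊑ pstar t) /\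
  (* (4) *)
  (forall s : S, s \in Pcomp S -> pstar s \in Pcomp S ->
     s ⊑ pstar (pstar s)) /\
  (* (5) *)
  (forall s : S, s \in Pcomp S -> pstar s \in Pcomp S ->
     pstar (pstar s) \in Pcomp S ->
     pstar (pstar (pstar s)) = pstar s) /\
  (* (6) *)
  (forall s : S, s \in Pcomp S -> pstar s \in Pcomp S ->
     forall t : S, s * t = 0 <-> pstar (pstar s) * t = 0) /\
  (* (7) *)
  (forall s t : S, s \in Pcomp S -> t \in Pcomp S ->
     s ⊑ t -> pstar t ⊑ pstar s) /\
  (* (8) *)
  (forall s : S, s \in Pcomp S -> pstar s \in Pcomp S ->
     (s \in Skel S <-> pstar (pstar s) = s)).
Proof.
split=> [P0 s|].
  (* The upper bound is (3) at $t = 0$, since $s \cdot 0 = 0$. *)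
  by split=> //; apply/mul_eq0_le_pstar; rewrite ?mulr0.
split=> [s sP|]; first by split=> [|s1P]; apply: mul_pstar.
split=> [t tP s|]; first exact: mul_eq0_le_pstar.
split; first exact: le_pstar2.
split; first exact: pstar3.
split=> [s sP s1P t|]; first exact: pstar2_mul_eq0.
split; first exact: pstar_anti.
exact: Skel_pstar2.
Qed.
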